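(* For $n\in\mathbb{N}$, let $F(n)=\#\{(x,y)\in\mathbb{Z}^2 : x^2+y^2\le n\}$ be the number of lattice points in a disc of radius $\sqrt{n}$ centered at the origin. Then $$F(n) = 4\,\mathcal{N}_{\lceil n/2\rceil,\,1/2,\,\{n/2\},\,1,\,2}+4\left\lfloor\frac{n}{2}\right\rfloor+1,$$ where $\{n/2\}$ denotes the fractional part of $n/2$.
   Context: $\mathbb{N}$ denotes the set of positive integers; $\lfloor\cdot\rfloor$ and $\lceil\cdot\rceil$ are the floor and ceiling functions, and $\{x\}=x-\lfloor x\rfloor$. For $n,m\in\mathbb{N}$, $r\in\mathbb{Z}$ and $\alpha,\nu\in\mathbb{R}$, define $$\mathcal{N}_{n,\alpha,\nu,r,m}=\#\left\{k\in\mathbb{Z} : 1\le k\le n,\ \left\lfloor\frac{n-\nu}{k}+\alpha\right\rfloor\equiv r \pmod m\right\}.$$ *)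

(* Defs.v *)
From HB Require Import structures.
From mathcomp Require Import all_boot all_order all_algebra finmap.
From mathcomp Require Import all_classical all_reals.

Set Implicit Arguments.
Unset Strict Implicit.
Unset Printing Implicit Defensive.

Import Order.TTheory GRing.Theory Num.Theory.

Local Open Scope classical_set_scope.
Local Open Scope ring_scope.

Definition fracpart (R : realType) (x : R) : R := x - (Num.floor x)%:~R.

Definition Nset (R : realType) (n : nat) (alpha nu : R) (r : int) (m : nat) :
    set int :=
  [set k : int | 1 <= k <= n%:Z /\
     (Num.floor ((n%:R - nu) / k%:~R + alpha) = r %[mod m%:Z])%Z].

(* [fset_set] is the empty set on infinite sets; [finite_Nset] and
   [finite_disc] below show that this case does not arise. *)
Definition Ncount (R : realType) (n : nat) (alpha nu : R) (r : int) (m : nat) :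
    nat :=
  #|` fset_set (Nset n alpha nu r m)|%fset.

Definition disc (n : nat) : set (int * int) :=
  [set p : int * int | p.1 ^+ 2 + p.2 ^+ 2 <= n%:Z].

Definition F (n : nat) : nat := #|` fset_set (disc n)|%fset.

Lemma finite_int_norm_le (n : nat) : finite_set [set k : int | `|k| <= n%:Z].
Proof.
apply: (@sub_finite_set _ _
  ((Posz @` `I_n.+1) `|` ((fun i : nat => - i%:Z) @` `I_n.+1))).
  by move=> [] k /= kn; [left; exists k | right; exists k.+1].
by rewrite finite_setU; split; apply: finite_image; apply: finite_II.
Qed.

Lemma finite_Nset (R : realType) (n : nat) (alpha nu : R) (r : int) (m : nat) :
  finite_set (Nset n alpha nu r m).
Proof.
apply: sub_finite_set (finite_int_norm_le n) => k [/andP[k1 kn] _] /=.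
by rewrite ger0_norm // (le_trans _ k1).
Qed.

Lemma finite_disc (n : nat) : finite_set (disc n).
Proof.
have sqr_norm (a b : int) : a ^+ 2 + b ^+ 2 <= n%:Z -> `|a| <= n%:Z.
  move=> ab; apply: le_trans ab; apply: (@le_trans _ _ (a ^+ 2)); last first.
    by rewrite lerDl sqr_ge0.
  rewrite -(real_normK (num_real a)) expr2.
  have [->|a0] := eqVneq a 0; first by rewrite normr0 mulr0.
  by rewrite ler_peMr // -gtz0_ge1 normr_gt0.
apply: sub_finite_set (finite_setX (finite_int_norm_le n) (finite_int_norm_le n)).
move=> [a b] /= ab; split => /=; first exact: sqr_norm ab.
by apply: (@sqr_norm b a); rewrite addrC.
Qed.

(* Main.v *)
Require Import Defs.
From mathcomp Require Import all_boot all_order all_algebra finmap.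
From mathcomp Require Import all_classical all_reals zify ring.

(* Let [chi] be the nontrivial character modulo 4.  Jacobi's two-square theorem,
   [r2 m = 4 * sum_(d | m) chi d], holds because both sides satisfy the same
   recursion in each prime [p]: with [g (m / p) = 0] when [p] does not divide [m],
   [g (p m) + chi p * g (m / p) = (1 + chi p) * g m].  For [r2] and a prime
   [p = a ^ 2 + b ^ 2] this is inclusion-exclusion over the Gaussian multiples
   of [a + b i] and [a - b i]; if [p] is 3 modulo 4, then [p] divides both
   coordinates of every representation of [p m].

   Summing over [m <= n] gives [F n = 1 + 4 * sum_(d k <= n) chi d].  Carrying out
   the sum over [d] first, the partial sums of [chi] up to [q = floor (n / k)] are
   [1] or [0] according to the parity of [floor ((q + 1) / 2)], which equals
   [floor (n / (2 k) + 1 / 2)].  The [k <= ceil (n / 2)] give the count in the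
   statement, and each of the [floor (n / 2)] larger [k] contributes [1]. *)

Set Implicit Arguments.
Unset Strict Implicit.
Unset Printing Implicit Defensive.

Import Order.TTheory GRing.Theory Num.Theory.

Local Open Scope ring_scope.

(** * Arithmetic modulo a prime, and primes that are sums of two squares *)

Lemma Fp_intr_eq0 (p : nat) (p_prime : prime p) (z : int) :
  (z%:~R == 0 :> 'F_p) = (p%:Z %| z)%Z.
Proof.
have hp := pchar_Fp p_prime.
case: z => n; first by rewrite -pmulrn -(dvdn_pcharf hp).
by rewrite NegzE mulrNz oppr_eq0 dvdzE abszN -pmulrn -(dvdn_pcharf hp).
Qed.

Lemma Fp_expp (p : nat) (p_prime : prime p) (a : 'F_p) : a ^+ p = a.
Proof.
by rewrite -[in LHS](natr_Zp a) -natrX -(Fp_nat_mod p_prime) fermat_little //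
  Fp_nat_mod ?natr_Zp.
Qed.

(** If [b] were nonzero, [t = a / b] would be a square root of [-1]. Writing [p = 2 (2 k + 1) + 1]
    gives [t ^ p = - t], while Fermat gives [t ^ p = t]. *)
Lemma Fp_sum_sqr_eq0 (p : nat) (p_prime : prime p) (a b : 'F_p) :
  (p %% 4)%N = 3%N -> a ^+ 2 + b ^+ 2 = 0 -> b = 0.
Proof.
move=> p3 ab; apply/eqP/negPn/negP => b0.
pose t := a / b.
have t2 : t ^+ 2 = -1.
  by rewrite /t expr_div_n; move/eqP: ab; rewrite addr_eq0 => /eqP ->;
    rewrite mulNr divff // expf_eq0 (negPf b0).
have pE : p = (2 * (2 * (p %/ 4)).+1).+1 by lia.
have := Fp_expp p_prime t; rewrite [X in _ ^+ X]pE.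
rewrite exprS exprM t2 exprS exprM sqrrN !expr1n mulr1 mulrN1 => /eqP.
rewrite -subr_eq0 -opprD oppr_eq0 -mulr2n -mulr_natr mulf_eq0.
have -> : (t == 0) = false.
  by apply/eqP => t0; move/eqP: t2; rewrite t0 expr0n /= eq_sym oppr_eq0 oner_eq0.
have := Fp_intr_eq0 p_prime 2; rewrite -pmulrn => -> /=.
by rewrite dvdzE /= => /dvdn_leq; lia.
Qed.

(** Modulo [p], the top [j] factors of [(p-1)!] are [-1, ..., -j]. For [j = (p-1)/2] this exhibits
    [(p-1)!] as a square up to sign. *)
Lemma Fp_fact_reflect (p : nat) (p_prime : prime p) (j : nat) : (j < p)%N ->
  p.-1`!%:R = (-1) ^+ j * j`!%:R * (p.-1 - j)`!%:R :> 'F_p.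
Proof.
elim: j => [|j IH] jp; first by rewrite expr0 mul1r subn0 mul1r.
rewrite IH ?(ltnW jp) // (_ : (p.-1 - j = (p.-1 - j.+1).+1)%N); last by lia.
rewrite !factS !natrM.
have -> : (p.-1 - j.+1).+1%:R = - j.+1%:R :> 'F_p.
  apply/eqP; rewrite -addr_eq0 -natrD (_ : (_ + _ = p)%N) ?pchar_Fp_0 //.
  by lia.
rewrite exprS; ring.
Qed.

(* Wilson's theorem gives [-1 = (p-1)! = ((p-1)/2)!^2]. *)
Lemma Fp_sqrtN1 (p : nat) (p_prime : prime p) :
  (p %% 4)%N = 1%N -> exists c : 'F_p, c ^+ 2 = -1.
Proof.
move=> p1; pose k := (p %/ 4)%N.
have pE : p.-1 = (2 * k + 2 * k)%N by rewrite /k; lia.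
exists ((2 * k)`!%:R).
have := Wilson (prime_gt1 p_prime); rewrite p_prime => /esym.
rewrite (dvdn_pcharf (pchar_Fp p_prime)) -natr1.
rewrite (@Fp_fact_reflect p p_prime (2 * k)); last by lia.
by rewrite pE addnK exprM sqrrN expr1n expr1n mul1r addr_eq0 -expr2 => /eqP.
Qed.

(* Thue's pigeonhole argument: if [c ^ 2 = -1], two of the more than [p] values
   [u - c v] with [u, v < sqrt p + 1] coincide. *)
Lemma prime_sum_sqr (p : nat) : prime p -> (p %% 4)%N = 1%N ->
  exists a b : int, a ^+ 2 + b ^+ 2 = p%:Z.
Proof.
move=> pp p1; have [c c2] := Fp_sqrtN1 pp p1.
have [s /andP[sp ps]] : exists s : nat, (s * s <= p < s.+1 * s.+1)%N.
  have ex : exists s, (s * s <= p)%N by exists 0%N.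
  have ub s : (s * s <= p)%N -> (s <= p)%N by nia.
  case: (ex_maxnP ex ub) => s sp smax; exists s; rewrite sp /= ltnNge.
  by apply/negP => /smax; rewrite ltnn.
(* A prime is not a square, so [s * s < p] strictly; this rules out [x ^ 2 + y ^ 2 = 2 p] below. *)
have sNp : (s * s != p)%N.
  apply/negP => /eqP sE; have := pp; rewrite -sE => /primeP[s1 /(_ s)].
  by rewrite dvdn_mulr // => /(_ isT) /orP[/eqP|/eqP]; nia.
pose f (u : 'I_s.+1 * 'I_s.+1) : 'F_p := (u.1 : nat)%:R - c * (u.2 : nat)%:R.
have /injectivePn[[u1 u2] [[v1 v2] uv]] : ~~ injectiveb f.
  apply/negP => /injectiveP/leq_card.
  by rewrite card_prod !card_ord Fp_cast // leqNgt ps.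
rewrite /f /= => fuv.
pose x : int := (u1 : nat)%:Z - (v1 : nat)%:Z.
pose y : int := (u2 : nat)%:Z - (v2 : nat)%:Z.
have xy : x%:~R = c * y%:~R :> 'F_p.
  rewrite /x /y !rmorphB /= -!pmulrn; apply/eqP.
  by rewrite mulrBr subr_eq -addrA [X in _ == X]addrC [- _ + _]addrC -subr_eq fuv.
have /dvdzP[q qE] : (p%:Z %| x ^+ 2 + y ^+ 2)%Z.
  by rewrite -Fp_intr_eq0 // rmorphD !rmorphXn /= xy exprMn c2 mulN1r addNr.
exists x, y; rewrite qE.
have xy0 : x <> 0 \/ y <> 0.
  have [x0|/eqP] := eqVneq x 0; last by left.
  right => y0; case/eqP: uv; congr (_, _); apply: val_inj => /=; lia.
have xs : `|x| <= s%:Z by have := ltn_ord u1; have := ltn_ord v1; rewrite /x; lia.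
have ys : `|y| <= s%:Z by have := ltn_ord u2; have := ltn_ord v2; rewrite /y; lia.
have sqr_le (z : int) : `|z| <= s%:Z -> z ^+ 2 <= s%:Z * s%:Z.
  by move=> zs; rewrite -real_normK ?num_real // expr2 ler_pM.
have q1 : q = 1; last by rewrite q1 mul1r.
have sltp : s%:Z * s%:Z < p%:Z by lia.
have qle : q * p%:Z < 2 * p%:Z by rewrite -qE; have := sqr_le x xs; have := sqr_le y ys; lia.
have qgt : 0 < q * p%:Z.
  rewrite -qE; case: xy0 => /eqP nz; [rewrite ltr_pwDl | rewrite ltr_wpDl];
  by rewrite ?sqr_ge0 // lt_def sqr_ge0 expf_eq0 /= nz.
have p0 : 0 < p%:Z :> int by have := prime_gt0 pp.
move: qgt qle; rewrite pmulr_lgt0 // ltr_pM2r //; lia.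
Qed.

(** * Representations as sums of two squares, and their recursion at each prime *)

Definition circle (n : nat) : set (int * int) :=
  [set z | z.1 ^+ 2 + z.2 ^+ 2 = n%:Z]%classic.

Definition r2 (n : nat) : nat := #|` fset_set (circle n)|%fset.

Lemma finite_circle n : finite_set (circle n).
Proof. by apply: sub_finite_set (finite_disc n) => z zn; rewrite /disc /= zn. Qed.

Lemma card_fset_set_inj (T U : choiceType) (f : T -> U) (A : set T) :
  injective f -> finite_set A ->
  #|` fset_set (f @` A)%classic|%fset = #|` fset_set A|%fset.
Proof. by move=> f_inj finA; rewrite fset_set_image // card_imfset. Qed.

Lemma card_fset_setU (T : choiceType) (A B : set T) :
  finite_set A -> finite_set B ->
  (#|` fset_set (A `|` B)%classic| + #|` fset_set (A `&` B)%classic|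
    = #|` fset_set A| + #|` fset_set B|)%N.
Proof.
by move=> finA finB; rewrite fset_setU // fset_setI // cardfsUI.
Qed.

(* The Gaussian integers divisible by [a + b i]: those [z] for which
   [z * (a - b i)] is divisible by [a ^ 2 + b ^ 2]. *)
Definition gdvd (a b : int) : set (int * int) :=
  [set z | (a ^+ 2 + b ^+ 2 %| a * z.1 + b * z.2)%Z /\
           (a ^+ 2 + b ^+ 2 %| a * z.2 - b * z.1)%Z]%classic.

(** Multiplication by [a + b i], the map [f] below, is a bijection from the elements of norm [m]
    onto the multiples of [a + b i] of norm [N * m]; multiplying by the conjugate inverts it up to
    the factor [N]. *)
Lemma card_circle_gdvd (a b : int) (N m : nat) : (0 < N)%N ->
  a ^+ 2 + b ^+ 2 = N%:Z ->
  #|` fset_set (circle (N * m) `&` gdvd a b)%classic|%fset = r2 m.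
Proof.
move=> N0 abN.
have NZ : N%:Z != 0 by rewrite -lt0n.
pose f (z : int * int) := (a * z.1 - b * z.2, a * z.2 + b * z.1).
have fK z : (a * (f z).1 + b * (f z).2 = N%:Z * z.1)
          * (a * (f z).2 - b * (f z).1 = N%:Z * z.2).
  by split; rewrite /f /= -abN; ring.
have f_inj : injective f.
  move=> z w zw; have := fK z; rewrite zw !fK => -[/(mulfI NZ) e1 /(mulfI NZ) e2].
  by rewrite (surjective_pairing z) -e1 -e2 -surjective_pairing.
rewrite /r2 -(card_fset_set_inj f_inj (@finite_circle m)); congr (#|` fset_set _|%fset).
apply/seteqP; split => [[x y] [/= xyN []] | _ [z /= zm <-]].
  rewrite /= abN => /dvdzP[u uE] /dvdzP[v vE].
  have xE : x = a * u - b * v.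
    apply: (mulfI NZ).
    have -> : N%:Z * x = a * (a * x + b * y) - b * (a * y - b * x).
      by rewrite -abN; ring.
    by rewrite uE vE; ring.
  have yE : y = a * v + b * u.
    apply: (mulfI NZ).
    have -> : N%:Z * y = a * (a * y - b * x) + b * (a * x + b * y).
      by rewrite -abN; ring.
    by rewrite uE vE; ring.
  exists (u, v) => /=; last by rewrite /f /= -xE -yE.
  apply: (mulfI NZ); rewrite -PoszM -xyN xE yE -abN /=; ring.
split=> /=.
  rewrite /circle /= PoszM -zm -abN; ring.
rewrite /gdvd /= abN; have /= [-> ->] := fK z.
by rewrite !dvdz_mulr.
Qed.

Lemma card_circle_scale (p m : nat) : (0 < p)%N ->
  #|` fset_set (circle (p * m) `&`
      [set z | (p%:Z %| z.1)%Z /\ (p%:Z %| z.2)%Z])%classic|%fset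
  = (if p %| m then r2 (m %/ p) else 0)%N.
Proof.
move=> p0; have pZ : p%:Z != 0 by rewrite -lt0n.
case: ifPn => [/dvdnP[k ->] | pNm].
  (* Divisibility of both coordinates by [p] is divisibility by the Gaussian integer [p + 0 i], of
     norm [p * p]. *)
  rewrite mulnK // (mulnC k) mulnA -(@card_circle_gdvd p%:Z 0 (p * p)%N); last first.
  - by rewrite PoszM; ring.
  - by rewrite muln_gt0 p0.
  congr (#|` fset_set (_ `&` _)|%fset); apply/predeqP => z.
  by rewrite /gdvd /= expr0n addr0 !mul0r addr0 subr0 expr2 !dvdz_mul2l ?pZ.
apply/eqP; rewrite cardfs_eq0; apply/eqP.
suff -> : (circle (p * m) `&` [set z | (p%:Z %| z.1)%Z /\ (p%:Z %| z.2)%Z] = set0)%classic.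
  exact: fset_set0.
rewrite -subset0 => -[x y] [/= xy [/dvdzP[u xE] /dvdzP[v yE]]].
move/negP: pNm; apply; suff : (p%:Z %| m%:Z)%Z by rewrite dvdzE.
apply/dvdzP; exists (u ^+ 2 + v ^+ 2).
by apply: (mulfI pZ); rewrite -PoszM -xy /= xE yE; ring.
Qed.

(** Every Gaussian integer of even norm is a multiple of [1 + i], because [x + y] has the parity of
    [x ^ 2 + y ^ 2]. *)
Lemma r2_mul2 m : r2 (2 * m) = r2 m.
Proof.
rewrite -[in RHS](@card_circle_gdvd 1 1 2) //; congr (#|` fset_set _|%fset).
apply/seteqP; split => [[x y] xy|z []//]; split=> //.
have xDy : (2 %| x + y)%Z.
  suff : (2 %| (x + y) ^+ 2)%Z by rewrite !dvdzE abszX Euclid_dvdX // andbT.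
  rewrite sqrrD addrAC xy PoszM rpredD ?dvdz_mulr //.
  by rewrite -mulr_natl dvdz_mulr.
split; rewrite /= !mul1r //.
have -> : y - x = (x + y) - 2 * x by ring.
by rewrite rpredB // dvdz_mulr.
Qed.

Lemma r2_mul_prime3 p m : prime p -> (p %% 4)%N = 3%N ->
  r2 (p * m) = (if p %| m then r2 (m %/ p) else 0)%N.
Proof.
move=> pp p3; rewrite -card_circle_scale ?prime_gt0 //.
congr (#|` fset_set _|%fset); apply/seteqP; split => [[x y] /= xy|z []//].
have p_dvd (u v : int) : u ^+ 2 + v ^+ 2 = (p * m)%:Z -> (p%:Z %| v)%Z.
  move=> uv; rewrite -Fp_intr_eq0 //; apply/eqP.
  apply: (@Fp_sum_sqr_eq0 _ pp u%:~R) => //; rewrite -!rmorphXn -rmorphD /= uv.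
  by apply/eqP; rewrite Fp_intr_eq0 // PoszM dvdz_mulr.
by split=> //=; split; [apply: (p_dvd y); rewrite addrC | apply: (p_dvd x)].
Qed.

Lemma r2_mul_prime1 p m : prime p -> (p %% 4)%N = 1%N ->
  (r2 (p * m) + (if p %| m then r2 (m %/ p) else 0) = 2 * r2 m)%N.
Proof.
move=> pp p1; have [a [b ab]] := prime_sum_sqr pp p1.
have p0 := prime_gt0 pp.
have ab' : a ^+ 2 + (- b) ^+ 2 = p%:Z by rewrite sqrrN.
have prM (u v : int) : (p%:Z %| u * v)%Z = (p%:Z %| u)%Z || (p%:Z %| v)%Z.
  by rewrite !dvdzE abszM Euclid_dvdM.
have prX (u : int) : (p%:Z %| u ^+ 2)%Z = (p%:Z %| u)%Z by rewrite expr2 prM orbb.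
(* One of the two divisibilities in [gdvd] implies the other: the squares of the two forms add up to
   [p * (p * m)]. *)
have sub_gdvd (c d : int) (z : int * int) : c ^+ 2 + d ^+ 2 = p%:Z -> circle (p * m) z ->
    (p%:Z %| c * z.1 + d * z.2)%Z -> gdvd c d z.
  move=> cd zpm h; split; rewrite cd // -prX.
  have -> : (c * z.2 - d * z.1) ^+ 2 = p%:Z * (p * m)%:Z - (c * z.1 + d * z.2) ^+ 2.
    by rewrite -cd -zpm; ring.
  by rewrite rpredB ?dvdz_mulr // prX.
rewrite -card_circle_scale // mul2n -addnn.
(* The two copies of [r2 m] count the multiples of [a + b i] and of [a - b i]. Their union is the
   whole circle, and their intersection consists of the multiples of [p]. *)
rewrite -{1}(card_circle_gdvd m p0 ab) -(card_circle_gdvd m p0 ab').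
rewrite -card_fset_setU; try by apply: finite_setIl; apply: finite_circle.
congr addn; congr (#|` fset_set _|%fset); apply/seteqP; split.
- move=> z zpm; have : (p%:Z %| (a * z.1 + b * z.2) * (a * z.1 + (- b) * z.2))%Z.
    have -> : (a * z.1 + b * z.2) * (a * z.1 + - b * z.2)
       = a ^+ 2 * (p * m)%:Z - z.2 ^+ 2 * p%:Z by rewrite -ab -zpm; ring.
    by rewrite rpredB ?(dvdz_mull _ (dvdzz _)) // PoszM dvdz_mull ?dvdz_mulr.
  by rewrite prM => /orP[] h; [left|right]; split => //; apply: sub_gdvd.
- by move=> z [[]|[]].
- move=> z [zpm [z1 z2]]; split; split => //; apply: sub_gdvd => //;
  by rewrite rpredD // dvdz_mull.
- move=> z [[zpm [h1 _]] [_ [h2 _]]]; split=> //=.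
  move: h1 h2; rewrite ab ab' => h1 h2.
  have p2 : (p%:Z %| 2)%Z = false.
    by apply/negP; rewrite dvdzE => /dvdn_leq; have := prime_gt1 pp; lia.
  (* If [p] divided [a], it would divide [b] too, and then [p ^ 2] would divide
     [a ^ 2 + b ^ 2 = p]. *)
  have pNa : (p%:Z %| a)%Z = false.
    apply/negP => pa; have /dvdzP[v vE] : (p%:Z %| b)%Z.
      by rewrite -prX -(addKr (a ^+ 2) (b ^+ 2)) ab addrC rpredB // prX.
    have /dvdzP[u uE] := pa.
    have : p%:Z * 1 = p%:Z * (p%:Z * (u ^+ 2 + v ^+ 2)) by rewrite mulr1 -{1}ab uE vE; ring.
    have pZ : p%:Z != 0 by rewrite -lt0n.
    move/(mulfI pZ) => p1E.
    by have := dvdz_mulr (u ^+ 2 + v ^+ 2) (dvdzz p); rewrite -p1E dvdzE Euclid_dvd1.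
  have pNb : (p%:Z %| b)%Z = false.
    by apply: contraFF pNa => pb; rewrite -prX -(addrK (b ^+ 2) (a ^+ 2)) ab rpredB // prX.
  split.
    have := rpredD h1 h2.
    have -> : a * z.1 + b * z.2 + (a * z.1 + - b * z.2) = 2 * (a * z.1) by ring.
    by rewrite !prM p2 pNa.
  have := rpredB h1 h2.
  have -> : a * z.1 + b * z.2 - (a * z.1 + - b * z.2) = 2 * (b * z.2) by ring.
  by rewrite !prM p2 pNb.
Qed.

(** * The divisor sum of the character modulo 4 *)

Definition chi4 (d : nat) : int :=
  if (d %% 4 == 1)%N then 1 else if (d %% 4 == 3)%N then -1 else 0.

Lemma chi4M d e : chi4 (d * e) = chi4 d * chi4 e.
Proof.
rewrite /chi4 -modnMml -modnMmr.
by case: (d %% 4)%N (ltn_pmod d (isT : 0 < 4)%N) => [|[|[|[|]]]] //;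
   case: (e %% 4)%N (ltn_pmod e (isT : 0 < 4)%N) => [|[|[|[|]]]].
Qed.

Definition sum_chi4 (m : nat) : int := \sum_(d <- divisors m) chi4 d.

(** The divisors of [p m] are those of [m] together with the [p e] where [e] divides [m] but [p e]
    does not. The excluded [e], with [p e] dividing [m], are the divisors of [m / p]. *)
Lemma sum_chi4_mul_prime p m : prime p -> (0 < m)%N ->
  sum_chi4 (p * m) + chi4 p * (if (p %| m)%N then sum_chi4 (m %/ p) else 0)
  = (1 + chi4 p) * sum_chi4 m.
Proof.
move=> pp m0; have p0 := prime_gt0 pp; have pm0 : (0 < p * m)%N by rewrite muln_gt0 p0.
have old : \sum_(d <- divisors (p * m) | (d %| m)%N) chi4 d = sum_chi4 m.
  rewrite -big_filter; apply: perm_big; apply: uniq_perm => [||d];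
    rewrite ?filter_uniq ?divisors_uniq //.
  rewrite mem_filter -!dvdn_divisors //; apply/andP/idP => [[]//|dm].
  by rewrite dm dvdn_mull.
have new : \sum_(d <- divisors (p * m) | ~~ (d %| m)%N) chi4 d
         = chi4 p * \sum_(e <- divisors m | ~~ (p * e %| m)%N) chi4 e.
  rewrite -big_filter (perm_big (map (muln p) [seq e <- divisors m | ~~ (p * e %| m)%N])).
    by rewrite big_map big_filter big_distrr; apply: eq_bigr => e _; rewrite chi4M.
  apply: uniq_perm => [||d].
  - by rewrite filter_uniq ?divisors_uniq.
  - rewrite map_inj_uniq ?filter_uniq ?divisors_uniq // => x y /eqP.
    by rewrite eqn_pmul2l // => /eqP.
  rewrite mem_filter -dvdn_divisors //; apply/andP/mapP => [[dNm dpm]|[e]]; last first.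
    by rewrite mem_filter -dvdn_divisors // => /andP[peNm em] ->; rewrite peNm dvdn_pmul2l.
  have pd : (p %| d)%N.
    apply: contraR dNm => pNd; rewrite -(@Gauss_dvdr _ p) // coprime_sym prime_coprime //.
  have dE : (d = p * (d %/ p))%N by rewrite mulnC divnK.
  exists (d %/ p)%N => //; rewrite mem_filter -dE dNm -dvdn_divisors //=.
  by rewrite -(@dvdn_pmul2l p) // -dE.
have common : \sum_(e <- divisors m | (p * e %| m)%N) chi4 e
   = if (p %| m)%N then sum_chi4 (m %/ p) else 0.
  case: ifPn => [pm|pNm]; last first.
    rewrite big_pred0 // => e; apply: contraNF pNm; apply: dvdn_trans; exact: dvdn_mulr.
  have mp0 : (0 < m %/ p)%N by rewrite divn_gt0 // dvdn_leq.
  rewrite -big_filter; apply: perm_big; apply: uniq_perm => [||d];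
    rewrite ?filter_uniq ?divisors_uniq //.
  rewrite mem_filter -!dvdn_divisors // mulnC -dvdn_divRL //.
  by apply/andP/idP => [[]//|h]; split=> //; apply: dvdn_trans h (dvdn_div pm).
rewrite /sum_chi4 in old common *.
rewrite (bigID (fun d => d %| m)%N) /= old new -common.
rewrite [X in (1 + _) * X](bigID (fun d => p * d %| m)%N) /=.
rewrite [X in X + _ + _ = _](bigID (fun d => p * d %| m)%N) /=; ring.
Qed.

(** * Jacobi's two-square theorem *)

Lemma r2_0 : r2 0 = 1%N.
Proof.
rewrite /r2; have -> : (circle 0 = [set (0, 0)])%classic.
  apply/seteqP; split => [[x y]|_ ->]; last by rewrite /circle /=.
  rewrite /circle /= => /eqP; rewrite paddr_eq0 ?sqr_ge0 // !sqrf_eq0.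
  by case/andP => /eqP-> /eqP->.
by rewrite fset_set1 cardfs1.
Qed.

Lemma r2_1 : r2 1 = 4%N.
Proof.
pose s : seq (int * int) := [:: (1, 0); (-1, 0); (0, 1); (0, -1)].
rewrite /r2; have -> : (circle 1 = [set` [fset z in s]%fset])%classic.
  apply/seteqP; split => [[x y]|[x y]] /=; rewrite !inE /circle /=.
    move=> xy; have xb : -1 <= x <= 1 by nia.
    have yb : -1 <= y <= 1 by nia.
    have xE : x = -1 \/ x = 0 \/ x = 1 by lia.
    have yE : y = -1 \/ y = 0 \/ y = 1 by lia.
    by case: xE xy => [->|[->|->]]; case: yE => [->|[->|->]].
  by rewrite orbF => /or4P[] /eqP[-> ->].
by rewrite set_fsetK card_fseq.
Qed.

(** Strong induction: for the least prime factor [p] of [m = p k], the recursions express both sides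
    through their values at [k] and, if [p] divides [k], at [k / p]. *)
Lemma jacobi_two_squares m : (0 < m)%N -> (r2 m)%:Z = 4 * sum_chi4 m.
Proof.
elim/ltn_ind: m => m IH m0.
have [->|m1] := eqVneq m 1%N; first by rewrite r2_1 /sum_chi4 big_seq1.
have {m1} m1 : (1 < m)%N by rewrite ltn_neqAle eq_sym m1.
pose p := pdiv m; have pp : prime p := pdiv_prime m1.
have p1 := prime_gt1 pp; have p0 := prime_gt0 pp.
have [k mE] : exists k, m = (p * k)%N.
  by exists (m %/ p)%N; rewrite mulnC divnK // pdiv_dvd.
have k0 : (0 < k)%N by move: m0; rewrite mE muln_gt0 => /andP[].
have IHk : (r2 k)%:Z = 4 * sum_chi4 k by apply: IH => //; rewrite mE -{1}(mul1n k) ltn_pmul2r.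
have IHkp : (p %| k)%N -> (r2 (k %/ p))%:Z = 4 * sum_chi4 (k %/ p).
  move=> pk; apply: IH; last by rewrite divn_gt0 // dvdn_leq.
  by apply: leq_ltn_trans (leq_div k p) _; rewrite mE -{1}(mul1n k) ltn_pmul2r.
have := sum_chi4_mul_prime pp k0; rewrite mE /chi4.
have [p2|[p1'|p3]] : p = 2%N \/ (p %% 4)%N = 1%N \/ (p %% 4)%N = 3%N.
- have [->|] := even_prime pp; first by left.
  by rewrite -[odd p]negbK -dvdn2; lia.
- rewrite p2 /= mul0r addr0 addr0 mul1r => ->; rewrite r2_mul2 IHk //.
- rewrite p1' /=; have := r2_mul_prime1 k pp p1'.
  by case: ifP => [/IHkp|_]; lia.
- rewrite p3 /= r2_mul_prime3 //.
  by case: ifP => [/IHkp|_]; lia.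
Qed.

(** * Summation over the disc and exchange of the order of summation *)

Lemma F_sum_r2 n : F n = (\sum_(0 <= m < n.+1) r2 m)%N.
Proof.
elim: n => [|n IH].
  rewrite big_nat1 /F /r2; congr (#|` fset_set _|%fset).
  apply/seteqP; split=> z; rewrite /disc /circle /=; last by move=> ->.
  by move=> z0; apply/eqP; rewrite eq_le z0 addr_ge0 ?sqr_ge0.
rewrite big_nat_recr //= -IH /F /r2 -(card_fset_setU (@finite_disc n) (@finite_circle n.+1)).
rewrite [X in (_ + #|` fset_set X|)%N](_ : _ = set0)%classic.
  rewrite fset_set0 cardfs0 addn0; congr (#|` fset_set _|%fset).
  apply/seteqP; split=> z; rewrite /disc /circle /=; last by case; lia.
  by move: (_ + _) => t; have [|?] := leP t n%:Z; [left|right; lia].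
by apply/seteqP; split=> // z []; rewrite /disc /circle /=; lia.
Qed.

(** Each [d] divides exactly [n %/ d] of the integers from [1] to [n]. *)
Lemma sum_sum_chi4 n :
  \sum_(1 <= m < n.+1) sum_chi4 m = \sum_(1 <= d < n.+1) chi4 d * (n %/ d)%:Z.
Proof.
under [RHS]eq_bigr do rewrite divn_count_dvd -natz natr_sum big_distrr /=.
rewrite exchange_big /=; apply: eq_big_nat => m /andP[m0 mn].
transitivity (\sum_(1 <= d < n.+1 | (d %| m)%N) chi4 d).
  rewrite -big_filter; apply: perm_big; apply: uniq_perm => [||d].
  - by rewrite divisors_uniq.
  - by rewrite filter_uniq ?iota_uniq.
  rewrite mem_filter mem_index_iota -dvdn_divisors //; apply/idP/andP => [dm|[]//].
  by rewrite dm (dvdn_gt0 m0 dm) (leq_ltn_trans (dvdn_leq m0 dm)).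
by rewrite big_mkcond; apply: eq_bigr => d _; case: (d %| m)%N; rewrite ?mulr1 ?mulr0.
Qed.

(** From [q = 1] on, the partial sums repeat the pattern 1, 1, 0, 0. *)
Lemma sum_chi4_iota q : \sum_(1 <= d < q.+1) chi4 d = odd (q.+1 %/ 2).
Proof.
elim: q => [|q IH]; first by rewrite big_geq.
rewrite big_nat_recr //= IH /chi4; do 2?[case: ifP]; lia.
Qed.

(* Both sides sum [chi4 d] over the [d] and [k] with [d * k <= n]. *)
Lemma hyperbola_chi4 n :
  \sum_(1 <= d < n.+1) chi4 d * (n %/ d)%:Z
  = (\sum_(1 <= k < n.+1) odd ((n %/ k).+1 %/ 2))%N%:Z.
Proof.
rewrite -natz natr_sum.
have hyp d (G : nat -> int) : (0 < d)%N ->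
    \sum_(1 <= k < (n %/ d).+1) G k = \sum_(1 <= k < n.+1 | (d * k <= n)%N) G k.
  move=> d0; rewrite (big_nat_widen _ _ n.+1) ?ltnS ?leq_div //=.
  by apply: eq_bigl => k; rewrite ltnS leq_divRL // mulnC.
transitivity (\sum_(1 <= d < n.+1) \sum_(1 <= k < n.+1 | (d * k <= n)%N) chi4 d).
  apply: eq_big_nat => d /andP[d0 _].
  by rewrite -hyp // sumr_const_nat subn1 /= -mulr_natr natz.
rewrite (exchange_big_dep predT) //=; apply: eq_big_nat => k /andP[k0 _].
rewrite natz -sum_chi4_iota hyp //.
by apply: eq_bigl => d; rewrite mulnC.
Qed.

Lemma F_eq_sum_odd n :
  (F n)%:Z = 1 + 4 * (\sum_(1 <= k < n.+1) odd ((n %/ k).+1 %/ 2))%N%:Z.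
Proof.
rewrite F_sum_r2 big_ltn // r2_0 -hyperbola_chi4 -sum_sum_chi4 PoszD; congr (_ + _).
rewrite big_distrr /= -natz natr_sum.
by apply: eq_big_nat => m /andP[m0 _]; rewrite natz jacobi_two_squares.
Qed.

(* For [k > n / 2] the quotient [n %/ k] is [1]. *)
Lemma sum_odd_split n :
  (\sum_(1 <= k < n.+1) odd ((n %/ k).+1 %/ 2)
   = \sum_(1 <= k < (uphalf n).+1) odd ((n %/ k).+1 %/ 2) + n./2)%N.
Proof.
have un : (uphalf n <= n)%N by lia.
rewrite (big_cat_nat (n := (uphalf n).+1)) //=; congr addn.
rewrite (eq_big_nat _ _ (F2 := fun=> 1%N)) => [|k /andP[k1 k2]].
  by rewrite sum_nat_const_nat muln1; lia.
by rewrite (_ : n %/ k = 1)%N //; apply/eqP; rewrite eqn_leq -ltnS ltn_divLR ?leq_divRL; lia.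
Qed.

(** * Floors, ceilings and the count in the statement *)

Lemma floor_natr_div (R : realType) (m d : nat) : (0 < d)%N ->
  Num.floor (m%:R / d%:R : R) = (m %/ d)%N%:Z.
Proof.
move=> d0; have dR : 0 < d%:R :> R by rewrite ltr0n.
apply: floor_def; rewrite intrD -!pmulrn -natrD; apply/andP; split.
  by rewrite ler_pdivlMr // -natrM ler_nat leq_trunc_div.
by rewrite ltr_pdivrMr // -natrM ltr_nat addn1 ltn_ceil.
Qed.

Lemma ceil_half (R : realType) (n : nat) : Num.ceil (n%:R / 2 : R) = (uphalf n)%:Z.
Proof.
apply: ceil_def; rewrite rmorphB /= -!pmulrn; apply/andP; split.
  by rewrite ltr_pdivlMr // mulrBl mul1r ltrBlDr -natrM -natrD ltr_nat; lia.
by rewrite ler_pdivrMr // -natrM ler_nat; lia.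
Qed.

(** This explains the shift by the fractional part: it undoes the rounding of [n / 2], so the
    numerator in [Nset] is exactly [n / 2]. *)
Lemma uphalf_sub_fracpart (R : realType) (n : nat) :
  (uphalf n)%:R - fracpart (n%:R / 2) = n%:R / 2 :> R.
Proof.
rewrite /fracpart (@floor_natr_div R n 2) // -pmulrn opprB addrCA divn2 addrA.
have -> : (uphalf n)%:R = n%:R - n./2%:R :> R.
  by rewrite -natrB; [congr _%:R; lia | lia].
by field.
Qed.

Lemma Nset_half (R : realType) (n : nat) :
  Nset (uphalf n) (1 / 2) (fracpart (n%:R / 2 : R)) 1 2 =
  [set` [fset Posz k | k in [seq k <- index_iota 1 (uphalf n).+1
                            | odd ((n %/ k).+1 %/ 2)]]%fset]%classic.
Proof.
have floorE (k : nat) : (0 < k)%N ->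
    Num.floor ((n%:R / 2) / k%:R + 1 / 2 : R) = ((n %/ k).+1 %/ 2)%N%:Z.
  move=> k0; have kR : 0 < k%:R :> R by rewrite ltr0n.
  (* Over the common denominator [2 k], the floor becomes a natural division by [k] and then by
     [2]. *)
  have -> : n%:R / 2 / k%:R + 1 / 2 = (n + k)%:R / (k * 2)%:R :> R.
    by rewrite natrD natrM; field; rewrite gt_eqF.
  rewrite floor_natr_div ?muln_gt0 ?k0 //.
  by rewrite divnMA divnDr ?dvdnn // divnn k0 addn1.
have oddE (q : nat) : (q%:Z = 1 %[mod 2])%Z <-> odd q by lia.
rewrite /Nset uphalf_sub_fracpart; apply/seteqP; split => [k [/andP[k1 kn] kE]|k].
  case: k k1 kn kE => // k k1 kn; rewrite -pmulrn floorE // => /oddE ko.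
  by apply/imfsetP; exists k => //=; rewrite mem_filter ko mem_index_iota; lia.
case/imfsetP => j /=; rewrite mem_filter mem_index_iota => /andP[jo /andP[j1 jn]] ->.
split; first by lia.
by rewrite -pmulrn floorE //; apply/oddE.
Qed.

Lemma Ncount_half (R : realType) (n : nat) :
  Ncount (uphalf n) (1 / 2) (fracpart (n%:R / 2 : R)) 1 2
  = (\sum_(1 <= k < (uphalf n).+1) odd ((n %/ k).+1 %/ 2))%N.
Proof.
rewrite /Ncount Nset_half set_fsetK card_imfset; last by move=> i j [].
by rewrite /= undup_id ?filter_uniq ?iota_uniq // size_filter -sumn_count sumnE big_map.
Qed.

Theorem proposition5p1 (R : realType) (n : nat) (hn : (0 < n)%N) :
  (F n)%:Z =
    4 * (Ncount `|Num.ceil (n%:R / 2 : R)|%N (1 / 2) (fracpart (n%:R / 2 : R)) 1 2)%:Z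
    + 4 * Num.floor (n%:R / 2 : R) + 1.
Proof.
rewrite ceil_half Ncount_half (@floor_natr_div R n 2) // divn2.
by rewrite F_eq_sum_odd sum_odd_split PoszD; ring.
Qed.
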